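(* Let $G$ be a $k$-uniform parsimonious game with $h$ types, i.e. a parsimonious game with free type representation $(k,k,\ldots,k)$ (with $h-1$ components). Then the type weights of all types but the top one are the first $h-1$ $k$-Fibonacci numbers: $$w_t=F_t(k)\qquad\text{for } t=1,\ldots,h-1.$$
   Context: A constant sum homogeneous weighted majority game on a finite player set $N$ is a simple game ($v(S)\in\{0,1\}$ for every $S\subseteq N$), constant sum ($v(S)+v(N\setminus S)=1$), admitting a (unique) minimal homogeneous representation $(q,\mathbf{w})$: the individual weights $w_j$ are integers in nondecreasing order, some players have weight $1$, $v(S)=1$ if and only if $w(S):=\sum_{j\in S}w_j\ge q$, with $q=\frac{1+w(N)}{2}$, and $w(S)=q$ for every minimal winning coalition $S$ (a coalition with $v(S)=1$ and $v(T)=0$ for all $T\subsetneq S$). The number $q$ is the minimal winning quota of the game. A parsimonious game ($P$ game) is a constant sum homogeneous weighted majority game with $n>3$ players, none of them dummy, having exactly $n$ minimal winning coalitions (the smallest possible number). Recalled facts about $P$ games (known, due to earlier work). Group the players by equal weight in the minimal homogeneous representation into $h$ types ($2\le h\le n-2$) with type weights $w_1<w_2<\cdots<w_h$, and let $x_t\geq 1$ be the number of players of type $t$. Then $x_1>1$, $x_{h-1}>1$, $x_h=1$. The vector $(x_1,\ldots,x_h)$ is the type representation, and $(x_1,\ldots,x_{h-1})$ is the free type representation; it determines the game. With the convention $w_0=0$, the type weights satisfy $w_1=1$, $w_t=x_{t-1}w_{t-1}+w_{t-2}$ for $1<t<h$, and $w_h=(x_{h-1}-1)w_{h-1}+w_{h-2}$.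 A $P$ game is $k$-uniform if $x_t=k=\frac{n-1}{h-1}$ for all $t=1,\ldots,h-1$. For a positive integer $k$, the $k$-Fibonacci sequence is defined by $F_0(k)=0$, $F_1(k)=1$, $F_m(k)=k\,F_{m-1}(k)+F_{m-2}(k)$ for $m\ge2$. *)

(* Defs.v *)
From mathcomp Require Import all_boot.
Set Implicit Arguments.
Unset Strict Implicit.
Unset Printing Implicit Defensive.

Section Games.

(* The players are 'I_n.  A simple game is given by its {0,1}-valued           *)
(* characteristic function, with bool coerced to nat where it is added.        *)
Variable n : nat.
Implicit Types (v : {set 'I_n} -> bool) (S : {set 'I_n}) (q : nat).
Implicit Types (w : 'I_n -> nat) (k t : nat).

Definition constant_sum v : Prop := forall S, (v S + v (~: S) = 1)%N.

Definition min_winning v S : bool :=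
  v S && [forall T : {set 'I_n}, (T \proper S) ==> ~~ v T].

Definition dummy v (j : 'I_n) : Prop :=
  forall S, min_winning v S -> j \notin S.

Definition coalition_weight w S : nat := \sum_(j in S) w j.

(* minrep_quota is q = (1 + w(N)) / 2 as an exact division; it fixes the scale *)
(* of the weights.                                                             *)
Record min_homogeneous_rep v q w : Prop := MinHomogeneousRep {
  minrep_sorted : forall i j : 'I_n, i <= j -> w i <= w j;
  minrep_weight1 : exists j : 'I_n, w j = 1;
  minrep_winning : forall S, v S = (q <= coalition_weight w S);
  minrep_quota : q.*2 = 1 + coalition_weight w [set: 'I_n];
  minrep_homogeneous : forall S, min_winning v S -> coalition_weight w S = q
}.

Definition cs_homogeneous_wmg v : Prop :=
  constant_sum v /\ exists q w, min_homogeneous_rep v q w.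

Record parsimonious v : Prop := Parsimonious {
  pars_wmg : cs_homogeneous_wmg v;
  pars_players : 3 < n;
  pars_nodummy : forall j : 'I_n, ~ dummy v j;
  pars_minwin : #|[set S : {set 'I_n} | min_winning v S]| = n
}.

Definition type_weights w : seq nat := sort leq (undup (codom w)).

Definition num_types w : nat := size (type_weights w).

(* Types are numbered 1, ..., num_types w; type_weight w 0 = 0 is the          *)
(* convention w_0 = 0.                                                         *)
Definition type_weight w t : nat := nth 0 (0 :: type_weights w) t.

Definition type_count w t : nat := #|[set j : 'I_n | w j == type_weight w t]|.

(* The second conjunct is k = (n - 1) / (h - 1) as an exact division.          *)
Definition uniform k w : Prop :=
  (forall t, 1 <= t <= (num_types w).-1 -> type_count w t = k) /\
  k * (num_types w).-1 = n.-1.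

End Games.

Fixpoint kfib (k m : nat) : nat :=
  match m with
  | 0 => 0
  | 1 => 1
  | (m''.+1 as m').+1 => k * kfib k m' + kfib k m''
  end.

(* Main.v *)
(* Coalitions of weight exactly q are the minimal winning ones, and their
   incidence vectors span the whole space (uniqueness of the homogeneous
   representation); when there are only n of them they are therefore linearly
   independent.  Hence no minimal winning coalition can split two different
   types, since exchanging equal players in both types would produce a linear
   relation.  Climbing up the types, the heavier players always fall into two
   unions of complete types, completed to weight q by w_t and by
   w_(t-1) + k w_t respectively.  For a player of type t+1 in a minimal winning
   coalition, the constant-sum condition requires lighter players of total
   weight w_(t+1) - 1 outside the coalition, which bounds w_(t+1) by
   w_(t-1) + k w_t; were the inequality strict, some minimal winning coalition
   would split type t+1 and still contain lighter players, which is impossible. *)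
Require Import Defs.
From mathcomp Require Import all_boot all_algebra zify ring.
Set Implicit Arguments.
Unset Strict Implicit.
Unset Printing Implicit Defensive.
Import GRing.Theory Num.Theory.

(** * Additivity of coalition weights *)

Section CoalitionWeight.

Variables (n : nat) (w : 'I_n -> nat).
Local Notation W := (coalition_weight w).
Implicit Types (S T : {set 'I_n}) (i j : 'I_n).

Lemma weightD1 j S : j \in S -> W S = w j + W (S :\ j).
Proof. exact: big_setD1. Qed.

Lemma weightU1 j S : j \notin S -> W (j |: S) = w j + W S.
Proof. exact: big_setU1. Qed.

Lemma weightID S T : W S = W (S :&: T) + W (S :\: T).
Proof. exact: big_setID. Qed.

Lemma weightDS S T : T \subset S -> W S = W T + W (S :\: T).
Proof. by move=> sTS; rewrite (weightID S T) (setIidPr sTS). Qed.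

Lemma weightU S T : [disjoint S & T] -> W (S :|: T) = W S + W T.
Proof.
move=> dST; rewrite (weightDS (subsetUl S T)) setDUl setDv set0U.
by rewrite (setDidPl _) // disjoint_sym.
Qed.

Lemma weight_mono S T : T \subset S -> W T <= W S.
Proof. by move=> sTS; rewrite (weightDS sTS) leq_addr. Qed.

Lemma weightC S : W S + W (~: S) = W [set: 'I_n].
Proof. by rewrite (weightDS (subsetT S)) setTD. Qed.

Lemma weight0 : W set0 = 0.
Proof. exact: big_set0. Qed.

Lemma leq_weight j S : j \in S -> w j <= W S.
Proof. by move=> jS; rewrite (weightD1 jS) leq_addr. Qed.

Lemma weight_swap j j' S :
  j \in S -> j' \notin S -> w j = w j' -> W (j' |: (S :\ j)) = W S.
Proof.
move=> jS j'S e; rewrite weightU1 ?inE ?negb_and ?j'S ?orbT //.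
by rewrite (weightD1 jS) e.
Qed.

Lemma weight_const S c : {in S, forall j, w j = c} -> W S = #|S| * c.
Proof. by move=> wS; rewrite /coalition_weight (eq_bigr (fun=> c)) // sum_nat_const. Qed.

End CoalitionWeight.

(** * Filling and exchange in homogeneous constant-sum games *)

Section HomogeneousGame.

Variables (n : nat) (w : 'I_n -> nat) (q : nat).
Local Notation W := (coalition_weight w).
Implicit Types (S T U L X : {set 'I_n}) (i j l : 'I_n).

Hypothesis n_gt1 : 1 < n.
Hypothesis w_gt0 : forall j, 0 < w j.
Hypothesis quotaE : q.*2 = 1 + W [set: 'I_n].
Hypothesis homogeneous :
  forall S, q <= W S -> {in S, forall j, W S < q + w j} -> W S = q.
Hypothesis cover : forall j, exists2 S, W S = q & j \in S.
Hypothesis ex_unit : exists l, w l = 1.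

Let weightCq S : W S + W (~: S) + 1 = q.*2.
Proof. by rewrite weightC quotaE addnC. Qed.

(* Adding the players of L by decreasing weight to heavier players yields a
   minimal winning coalition as soon as it yields a winning one. *)
Lemma fill U L : [disjoint U & L] ->
  (forall i j, i \in U -> j \in L -> w j <= w i) ->
  W U <= q -> q <= W U + W L ->
  exists2 L' : {set 'I_n}, L' \subset L & W U + W L' = q.
Proof.
move=> dUL leLU; rewrite leq_eqVlt => /predU1P[<- _|ltUq leqUL].
  by exists set0; rewrite ?sub0set // weight0 addn0.
pose P (L' : {set 'I_n}) := (L' \subset L) && (q <= W U + W L').
have PL : P L by rewrite /P subxx.
case: (arg_minnP (fun L' : {set 'I_n} => #|L'|) PL) => L' /andP[sL'L leq'] minL'.
exists L' => //.
have dUL' : [disjoint U & L'] by apply: disjointWr dUL.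
have lt' j : j \in L' -> W U + W L' < q + w j.
  move=> jL'; rewrite ltnNge; apply/negP => le.
  have /minL' : P (L' :\ j).
    rewrite /P (subset_trans (subD1set _ _) sL'L) /=.
    by move: le; rewrite (weightD1 w jL'); lia.
  by rewrite (cardsD1 j L') jL' ltnn.
(* Removing any player of [U] loses at least as much weight as removing this [j], which already
   makes [U :|: L'] losing. *)
have [j jL'] : exists j, j \in L'.
  apply/set0Pn/eqP => L'0; move: leq'; rewrite L'0 weight0; lia.
rewrite -(weightU w dUL'); apply: homogeneous; rewrite (weightU w dUL') // => i.
rewrite inE => /orP[iU|/lt' //].
by apply: leq_trans (lt' j jL') _; rewrite leq_add2l leLU // (subsetP sL'L).
Qed.

Lemma exchange S j : W S = q -> j \in S ->
  exists T, [/\ T \subset ~: S, (W T).+1 = w j,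
                W (j |: (~: S :\: T)) = q & {in T, forall i, w i < w j}].
Proof.
move=> WS jS; have jS' : j \notin ~: S by rewrite inE jS.
have WL := weightU1 w jS'; have eq := weightCq S; have wj := w_gt0 j.
have d0 : [disjoint set0 & j |: ~: S] by rewrite disjoints_subset sub0set.
have [|||L' sL' WL'] := fill d0.
- by move=> ? ?; rewrite inE.
- by rewrite weight0.
- by rewrite weight0 WL; lia.
rewrite weight0 add0n in WL'.
have jL' : j \in L'.
  apply: contraTT (isT : true) => jL'.
  have : W L' <= W (~: S).
    apply/weight_mono/subsetP => i iL'.
    have := subsetP sL' _ iL'; rewrite in_setU1 => /predU1P[ij|//].
    by rewrite -ij iL' in jL'.
  by lia.
pose T := (j |: ~: S) :\: L'.
have TS : T \subset ~: S.
  apply/subsetP=> i; rewrite in_setD in_setU1 => /andP[iL' /predU1P[ij|//]].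
  by rewrite ij jL' in iL'.
have WT : (W T).+1 = w j by have := weightDS w sL'; rewrite -/T; lia.
exists T; split=> //.
- suff -> : j |: (~: S :\: T) = L' by [].
  apply/setP=> i; rewrite !inE; case: eqP => [->|ij] //=.
  have := subsetP sL' i; rewrite !inE.
  by case: (i \in L') => /=; case: (i \in S) => //=; case: eqP => // _ /(_ isT).
- by move=> i iT; rewrite -WT ltnS leq_weight.
Qed.

Lemma compl_unit S l : W S = q -> l \in S -> w l = 1 -> W (l |: ~: S) = q.
Proof.
move=> WS lS wl; rewrite weightU1 ?inE ?lS // wl.
by have := weightCq S; lia.
Qed.

(** A lightest player [j] other than [l] shares a coalition of weight [q] with [l], after passing to
    [l |: ~: S] if necessary. Exchanging [j] calls for lighter players outside it; there are none,
    so [T] is empty and [w j = 1]. *)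
Lemma second_unit l : w l = 1 -> exists2 l', l' != l & w l' = 1.
Proof.
move=> wl.
have [j0 j0l] : exists j, j != l.
  have /card_gt0P[j] : 0 < #|[set~ l]| by rewrite cardsC1 card_ord; lia.
  by rewrite !inE; exists j.
case: (@arg_minnP _ j0 (fun j => j != l) w j0l) => j jl minj.
exists j => //.
have [S WS lS] := cover l.
wlog jS : S WS lS / j \in S => [H|].
  have [|jS] := boolP (j \in S); first exact: H.
  by apply: (H (l |: ~: S)); rewrite ?compl_unit ?inE ?eqxx ?jS ?orbT.
have [T [sT WT _ ltT]] := exchange WS jS.
have [T0|[i iT]] := set_0Vmem T; first by rewrite -WT T0 weight0.
have [il|/minj] := eqVneq i l; last by rewrite leqNgt ltT.
by move/subsetP: sT => /(_ i iT); rewrite il inE lS.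
Qed.

Lemma winning_with_unit l j : w l = 1 ->
  exists S, [/\ W S = q, l \in S & j \in S].
Proof.
move=> wl; have [S WS lS] := cover l.
have [jS|jS] := boolP (j \in S); first by exists S.
by exists (l |: ~: S); rewrite compl_unit // !inE eqxx jS orbT.
Qed.

Lemma separate_units l l' : w l = 1 -> l' != l ->
  exists S, [/\ W S = q, l \in S & l' \notin S].
Proof.
move=> wl l'l; have [S WS lS] := cover l.
have [jS|jS] := boolP (l' \in S); last by exists S.
exists (l |: ~: S); rewrite compl_unit // !inE eqxx jS.
by rewrite (negPf l'l).
Qed.

(** * Linear independence of the minimal winning coalitions *)

Local Open Scope ring_scope.

(* The homogeneous representation is unique up to scaling: weights are
   determined by induction, each w j being 1 + w(T) for lighter players T. *)
Lemma winning_sums_eq0 (u : 'I_n -> rat) :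
  (forall S, W S = q -> \sum_(i in S) u i = 0) -> forall j, u j = 0.
Proof.
move=> u0; have [l wl] := ex_unit.
have uE j : u j = u l *+ w j.
  have [m] := ubnP (w j); elim: m j => // m IHm j lejm.
  have [S [WS lS jS]] := winning_with_unit j wl.
  have [T [sT WT /u0 WR ltT]] := exchange WS jS.
  (* The coalitions [l |: ~: S] and [j |: (~: S :\: T)] differ by trading [l] and [T] for [j], so
     [u j] is [u l] plus the sum of [u] over [T]. *)
  have := u0 _ (compl_unit WS lS wl).
  have lS' : l \notin ~: S by rewrite inE lS.
  have jS' : j \notin ~: S :\: T by rewrite !inE jS andbF.
  rewrite big_setU1 //= (big_setID T) /= (setIidPr sT).
  rewrite big_setU1 //= in WR.
  have -> : \sum_(i in T) u i = u l *+ W T.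
    rewrite /coalition_weight -sumrMnr; apply: eq_bigr => i iT.
    by apply: IHm; have := ltT i iT; lia.
  rewrite -WT mulrS addrA => e.
  by apply: (addIr (\sum_(i in ~: S :\: T) u i)); rewrite e.
have [S WS _] := cover l.
have := u0 S WS; under eq_bigr do rewrite uE.
rewrite sumrMnr -/(W S) WS => /eqP; rewrite mulrn_eq0 => /orP[|/eqP ul].
  by have := weightCq S; lia.
by move=> j; rewrite uE ul mul0rn.
Qed.

Hypothesis card_minwin : #|[set S | W S == q]| = n.

Let F : {set {set 'I_n}} := [set S | W S == q].

(* With n minimal winning coalitions the incidence matrix is square, and it has
   a trivial kernel by uniqueness of the representation. *)
Lemma minwin_free (f : {set 'I_n} -> rat) :
  (forall S, W S <> q -> f S = 0) ->
  (forall i, \sum_S f S * (i \in S)%:R = 0) -> forall S, f S = 0.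
Proof.
move=> f0 fsum.
pose M : 'M[rat]_(#|F|, n) := \matrix_(a < #|F|, i < n) (i \in enum_val a)%:R.
have Mfull : row_free M^T.
  rewrite -kermx_eq0; apply/eqP/row_matrixP => a; rewrite row0.
  set x := row a _; have xM : x *m M^T = 0 by rewrite -row_mul mulmx_ker row0.
  apply/rowP=> j; rewrite [RHS]mxE; apply: (winning_sums_eq0 (u := x 0)) => S WS.
  have SF : S \in F by rewrite inE WS.
  have := congr1 (fun A : 'rV__ => A 0 (enum_rank_in SF S)) xM.
  rewrite !mxE => xS; rewrite -[RHS]xS big_mkcond; apply: eq_bigr => i _.
  rewrite !mxE enum_rankK_in //.
  by case: (i \in S); rewrite ?mulr1 ?mulr0.
(* The rank of [M] is [n], which [card_minwin] identifies with its number of rows. *)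
have Mfree : row_free M.
  by move: Mfull; rewrite /row_free mxrank_tr => /eqP ->; rewrite card_minwin.
pose y : 'rV[rat]_#|F| := \row_(a < #|F|) f (enum_val a).
have yM : y *m M = 0.
  apply/rowP=> i; rewrite !mxE -[RHS](fsum i) (bigID (mem F)) /=.
  rewrite [X in _ = _ + X]big1 ?addr0; last first.
    by move=> S; rewrite inE => /eqP nS; rewrite (f0 _ nS) mul0r.
  by rewrite [RHS]big_enum_val /=; apply: eq_bigr => a _; rewrite !mxE.
have y0 : y = 0 by apply/eqP; rewrite -(mulmx_free_eq0 _ Mfree) yM.
move=> S; have [WS|/eqP/f0 //] := eqVneq (W S) q.
have SF : S \in F by rewrite inE WS.
have := congr1 (fun A : 'rV__ => A 0 (enum_rank_in SF S)) y0.
by rewrite !mxE enum_rankK_in.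
Qed.

Lemma minwin_parallelogram S1 S2 S3 S4 :
  W S1 = q -> W S2 = q -> W S3 = q -> W S4 = q ->
  (forall i, ((i \in S1) + (i \in S4) = (i \in S2) + (i \in S3))%N) ->
  S1 = S2 \/ S1 = S3.
Proof.
move=> W1 W2 W3 W4 e.
pose f S : rat := (S == S1)%:R + (S == S4)%:R - (S == S2)%:R - (S == S3)%:R.
have f0 S : f S = 0.
  apply: minwin_free => {S} [S WS|i].
    have neq S' : W S' = q -> (S == S') = false.
      by move=> WS'; apply/eqP=> SS'; apply: WS; rewrite SS'.
    by rewrite /f !neq // !subr0 addr0.
  have sumE S' : \sum_S (S == S')%:R * (i \in S)%:R = (i \in S')%:R :> rat.
    by rewrite (bigD1 S') //= eqxx mul1r big1 ?addr0 // => S /negPf ->; rewrite mul0r.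
  under eq_bigr do rewrite /f !mulrDl !mulNr.
  rewrite !big_split /= !sumrN !sumE -natrD e natrD.
  by ring.
have [|n2] := eqVneq S1 S2; first by left.
have [|n3] := eqVneq S1 S3; first by right.
(* The coefficient of [S1] in the relation would be 1 or 2. *)
have /eqP := f0 S1; rewrite /f eqxx (negPf n2) (negPf n3) !subr0.
by case: (S1 == S4).
Qed.

(* Types split by a minimal winning coalition *)
Local Close Scope ring_scope.

(* Otherwise swapping either pair, or both, gives a parallelogram. *)
Lemma minwin_splits_one_type X i i' j j' : W X = q ->
  i \in X -> i' \notin X -> w i = w i' ->
  j \in X -> j' \notin X -> w j = w j' -> w i = w j.
Proof.
move=> WX iX i'X wi jX j'X wj; apply/eqP/negPn/negP => nij.
have dij : i != j by apply: contraNneq nij => ->.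
have di'j : i' != j by apply: contraNneq nij => <-; rewrite wi.
have dij' : i != j' by apply: contraNneq nij => ->; rewrite wj.
have di'j' : i' != j' by apply: contraNneq nij => e; rewrite wi wj e.
pose Y := i' |: (X :\ i); pose Z := j' |: (X :\ j).
have WY : W Y = q by rewrite weight_swap.
have WZ : W Z = q by rewrite weight_swap.
have jY : j \in Y by rewrite !inE jX [j == i]eq_sym (negPf dij) orbT.
have j'Y : j' \notin Y by rewrite !inE (negPf j'X) [j' == i']eq_sym (negPf di'j') !andbF.
have WYZ : W (j' |: (Y :\ j)) = q by rewrite weight_swap.
have [m|XY|XZ] := minwin_parallelogram WX WY WZ WYZ.
- have dii' : i != i' by apply: contraNneq i'X => <-.
  have djj' : j != j' by apply: contraNneq j'X => <-.
  rewrite !inE.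
  have [->|mi] := eqVneq m i.
    by rewrite (negPf dij) (negPf dij') (negPf dii') iX.
  have [->|mj] := eqVneq m j.
    by rewrite jX [j == i']eq_sym (negPf di'j) (negPf djj').
  have [->|mi'] := eqVneq m i'; first by rewrite (negPf di'j') (negPf i'X).
  by case: eqP => [->|//]; rewrite (negPf j'X).
- by move: i'X; rewrite XY !inE eqxx.
- by move: j'X; rewrite XZ !inE eqxx.
Qed.

(** With a second unit [m] in [S], trading [m] and [l'] between [S] and [l |: ~: S] gives a
    parallelogram. It is not degenerate: [h] lies in exactly one of [S] and the modified
    complement. *)
Lemma splitting_unit_minwin S l l' h :
  W S = q -> l \in S -> l' \notin S -> w l = 1 -> w l' = 1 -> w h != 1 ->
  forall m, m \in S -> w m = 1 -> m = l.
Proof.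
move=> WS lS l'S wl wl' wh m mS wm; apply/eqP/negPn/negP => ml.
have ml' : m != l' by apply: contraNneq l'S => <-.
pose S' := l |: ~: S.
have WS' : W S' = q by apply: compl_unit.
have l'S' : l' \in S' by rewrite !inE l'S orbT.
have mS' : m \notin S' by rewrite !inE (negPf ml) mS.
have WS2 : W (l' |: (S :\ m)) = q by rewrite weight_swap // wm.
have WS3 : W (m |: (S' :\ l')) = q by rewrite weight_swap // wm.
have [i|e|e] := minwin_parallelogram WS WS2 WS3 WS'.
- rewrite !inE; have [->|im] := eqVneq i m.
    by rewrite mS (negPf ml) (negPf ml').
  have [->|il'] := eqVneq i l'; first by rewrite (negPf l'S) orbT.
  by [].
- by move: l'S; rewrite e !inE eqxx.
- have neq x : w x = 1 -> h != x by move=> wx; apply: contraNneq wh => ->; rewrite wx.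
  have := congr1 (fun A : {set 'I_n} => h \in A) e.
  rewrite !inE !(negPf (neq _ _)) //=.
  by case: (h \in S).
Qed.

(** * Climbing from one type to the next *)

Definition light a : {set 'I_n} := [set j | w j <= a].

(* The players heavier than a split into unions of complete types weighing
   q - a and q - a' - k * a, that is, what two consecutive types and their k
   copies leave to them. *)
Record tower k a' a : Prop := Tower {
  tower_split : exists A, [/\ W A + a = q, {in A, forall i, a < w i} &
                               forall i j, i \in A -> w i = w j -> j \in A];
  tower_light : (W (light a)).+1 = a' + k * a + a;
  tower_pure : forall X i i', W X = q -> i \in X -> i' \notin X ->
    w i = w i' -> a < w i -> {in X, forall j, a < w j} }.

Lemma light_disjoint a U : {in U, forall i, a < w i} -> [disjoint U & light a].
Proof.
move=> aU; rewrite disjoints_subset; apply/subsetP => i /aU.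
by rewrite !inE -ltnNge.
Qed.

Lemma fill_light a U : {in U, forall i, a < w i} ->
  W U <= q -> q <= W U + W (light a) ->
  exists L, [/\ L \subset light a, W U + W L = q & W (U :|: L) = q].
Proof.
move=> aU leUq leqU; have dU := light_disjoint aU.
have [|L sL WL] := fill dU _ leUq leqU.
  move=> i j /aU; rewrite inE => ai ja; exact: ltnW (leq_ltn_trans ja ai).
by exists L; split=> //; rewrite weightU // (disjointWr sL dU).
Qed.

(** The players exchanged for [j] lie outside [S] and weigh less than [c], hence at most [a]. *)
Lemma next_weight_bound a c S j : (forall i, a < w i -> c <= w i) ->
  W S = q -> j \in S -> w j = c -> c <= (W (light a :\: S)).+1.
Proof.
move=> next WS jS wj; have [T [sT WT _ ltT]] := exchange WS jS.
rewrite -wj -WT ltnS; apply/weight_mono/subsetP => i iT.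
rewrite !inE; have := subsetP sT i iT; rewrite inE => -> /=.
by rewrite leqNgt; apply: contraTN (ltT i iT) => /next; rewrite wj -leqNgt.
Qed.

Lemma tower_next k a' a c : 1 < k -> 0 < a -> tower k a' a ->
  a < c -> (forall i, a < w i -> c <= w i) -> #|[set j | w j == c]| = k ->
  c = k * a + a' /\ tower k a c.
Proof.
move=> k_gt1 a_gt0 [[A [WA aA fullA]] Wl pure] lt_ac next cardc.
have leaka : a + a <= k * a by rewrite addnn -mul2n leq_mul2r k_gt1 orbT.
pose B := ~: (light a :|: A).
have aB : {in B, forall i, a < w i}.
  by move=> i; rewrite !inE negb_or -ltnNge => /andP[].
have dA : [disjoint light a & A] by rewrite disjoint_sym light_disjoint.
have WB : W B + (a' + k * a) = q.
  by have := weightCq (light a :|: A); rewrite -/B weightU //; lia.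
have WD S L : L \subset light a -> {in S, forall i, a < w i} ->
    W (light a :\: (S :|: L)) = W (light a) - W L.
  move=> sL aS; rewrite setDUr (setDidPl _) 1?disjoint_sym ?light_disjoint //.
  by rewrite (weightDS w sL) (setIidPr (subsetDl _ _)) addKn.
have typec i j : w i = c -> w j = c -> i \in A -> j \in A.
  by move=> wi wj iA; apply: (fullA i) => //; rewrite wi.
have [j wj] : exists j, w j = c.
  have /card_gt0P[j] : 0 < #|[set j | w j == c]| by rewrite cardc; lia.
  by rewrite inE => /eqP; exists j.
(* Completing [B] to weight [q] leaves only [a - 1] of light weight outside, so a player of weight
   [c] in [B] would force [c <= a]. *)
have jA : j \in A.
  apply: contraLR (lt_ac) => jA; rewrite -leqNgt.
  have jB : j \in B by rewrite !inE negb_or jA wj -ltnNge lt_ac.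
  have [||L [sL WL WBL]] := fill_light aB; [lia..|].
  have jBL : j \in B :|: L by rewrite inE jB.
  have := next_weight_bound next WBL jBL wj; rewrite WD //; lia.
have other i : w i = c -> exists2 i', i' != i & w i' = c.
  move=> wi; have : 0 < #|[set j | w j == c] :\ i|.
    by have := cardsD1 i [set j | w j == c]; rewrite cardc !inE wi eqxx; lia.
  by case/card_gt0P=> i'; rewrite !inE => /andP[ni /eqP]; exists i'.
have cE : c = k * a + a'.
  apply/eqP; rewrite eqn_leq; apply/andP; split.
    (* Completing [A] takes light weight [a] and leaves [a' + k * a - 1] outside. *)
    have [||L [sL WL WAL]] := fill_light aA; [lia..|].
    have jAL : j \in A :|: L by rewrite inE jA.
    have := next_weight_bound next WAL jAL wj; rewrite WD //; lia.
  (* If [c] were smaller, light players could replace [j] in the completion of [A]. The result would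
     split the type of [j] and contain light players, against [tower_pure]. *)
  rewrite leqNgt; apply/negP => ltc.
  have WAj := weightD1 w jA; rewrite wj in WAj.
  have aAj : {in A :\ j, forall i, a < w i} by move=> i /setD1P[_ /aA].
  have [||L [sL WL WAL]] := fill_light aAj; [lia..|].
  have [i ij wi] := other j wj.
  have iA : i \in (A :\ j) :|: L by rewrite !inE ij (typec j).
  have jL : j \notin (A :\ j) :|: L.
    rewrite !inE eqxx /=; apply/negP => /(subsetP sL).
    by rewrite inE wj leqNgt lt_ac.
  have := pure _ _ _ WAL iA jL; rewrite wi wj => /(_ erefl lt_ac) aAL.
  have [L0|[l lL]] := set_0Vmem L; first by move: WL; rewrite L0 weight0; lia.
  have := aAL l; rewrite inE lL orbT => /(_ isT).
  by have := subsetP sL l lL; rewrite inE leqNgt => /negP.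
have lightE : light c = light a :|: [set j | w j == c].
  apply/setP=> i; rewrite !inE; case: (leqP (w i) a) => [|/next lei]; first by lia.
  by rewrite /= eqn_leq lei andbT.
have Wlc : W (light c) = W (light a) + k * c.
  rewrite lightE weightU.
    rewrite (@weight_const _ w [set j | w j == c] c) ?cardc // => i.
    by rewrite inE => /eqP.
  rewrite disjoints_subset; apply/subsetP => i; rewrite !inE; lia.
split=> //; split.
(* The two unions swap roles: [B] weighs [q - c], and [A] loses its players of weight [c]. *)
- exists B; split; [lia | | ].
    move=> i iB; have := next i (aB i iB); rewrite leq_eqVlt => /predU1P[ci|//].
    by move: iB; rewrite !inE (typec j i) // orbT.
  move=> i l; rewrite !inE => + wil; rewrite -wil.
  by rewrite !negb_or => /andP[-> /=]; apply: contra => lA; apply: (fullA l).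
- by rewrite -addn1 Wlc; lia.
move=> X i i' WX iX i'X wi ltci y yX.
have lti : a < w i by apply: ltn_trans ltci.
have aX := pure X i i' WX iX i'X wi lti.
have := next y (aX y yX); rewrite leq_eqVlt => /predU1P[/esym wy|//].
(* If [X] omits [z], it splits both the type of [y] and that of [i]. Otherwise replacing [y] by
   light players gives a coalition splitting both. *)
have [z zy wz] := other y wy.
have nci : w y <> w i by rewrite wy; lia.
have [zX|zX] := boolP (z \in X); last first.
  by case: nci; apply: (minwin_splits_one_type WX yX zX _ iX i'X wi); rewrite wz.
have WXy := weightD1 w yX; rewrite wy in WXy.
have aXy : {in X :\ y, forall i, a < w i} by move=> m /setD1P[_ /aX].
have [||L [sL WL WXL]] := fill_light aXy.
- by rewrite -WX WXy leq_addl.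
- by rewrite -WX WXy addnC leq_add2l; lia.
have heavy m : a < w m -> (m \in L) = false.
  by move=> am; apply/negP => /(subsetP sL); rewrite inE leqNgt am.
case: nci; rewrite wy -wz.
apply: (minwin_splits_one_type (X := (X :\ y) :|: L) (i' := y) (j' := i')) => //.
- by rewrite !inE zy zX.
- by rewrite !inE eqxx heavy // wy.
- by rewrite wy.
- rewrite !inE iX andbT; apply/orP; left.
  by apply: contraTneq ltci => ->; rewrite wy ltnn.
- by rewrite !inE (negPf i'X) andbF heavy // -wi.
Qed.

Lemma tower_base k h : w h != 1 -> #|[set j | w j == 1]| = k ->
  1 < k /\ tower k 0 1.
Proof.
move=> wh cardk; have [l wl] := ex_unit.
have [l' l'l wl'] := second_unit wl.
have k_gt1 : 1 < k.
  rewrite -cardk (cardsD1 l) (cardsD1 l') !inE wl wl' !eqxx.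
  by rewrite l'l.
have lightE : light 1 = [set j | w j == 1].
  by apply/setP=> i; rewrite !inE; have := w_gt0 i; lia.
have pure X i i' : W X = q -> i \in X -> i' \notin X ->
    w i = w i' -> 1 < w i -> {in X, forall j, 1 < w j}.
  move=> WX iX i'X wi lti j jX; rewrite ltnNge; apply/negP => wj.
  have {}wj : w j = 1 by have := w_gt0 j; lia.
  have allX m : w m = 1 -> m \in X.
    move=> wm; apply: contraTT lti => mX.
    by rewrite (minwin_splits_one_type WX iX i'X wi jX mX) wj ?wm.
  (* As [X] holds every unit, [j |: ~: X] has [j] as its only unit, and it still splits the type of
     [i]. *)
  have WX' := compl_unit WX jX wj.
  have [m mj wm] := second_unit wj.
  have neq y : w y = w i -> y != j.
    by move=> wy; apply: contraTneq lti => yj; rewrite -wy yj wj.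
  suff : w i' = 1 by rewrite -wi; lia.
  rewrite -wj; apply: (minwin_splits_one_type (i' := i) (j' := m) WX').
  - by rewrite !inE i'X orbT.
  - by rewrite !inE negb_or neq // iX.
  - by rewrite wi.
  - by rewrite !inE eqxx.
  - by rewrite !inE (negPf mj) allX.
  - by rewrite wj.
split=> //; split=> //; last first.
  rewrite lightE (@weight_const _ w [set j | w j == 1] 1); last first.
    by move=> i; rewrite inE => /eqP.
  by rewrite cardk muln1 addn1.
have [S [WS lS l'S]] := separate_units wl l'l.
have only := splitting_unit_minwin WS lS l'S wl wl' wh.
(* [S] splits the units, so it contains every other type entirely or not at all, and [l] is its only
   unit. *)
exists (S :\ l); split.
- by have := weightD1 w lS; lia.
- move=> i; rewrite !inE => /andP[il iS]; rewrite ltnNge; apply: contra il => wi.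
  by apply/eqP/only => //; have := w_gt0 i; lia.
- move=> i j; rewrite !inE => /andP[il iS] wij.
  have wi : w i != 1 by apply: contra il => /eqP wi; apply/eqP/only.
  apply/andP; split; first by apply: contraNneq wi => jl; rewrite wij jl wl.
  apply: contraNT wi => jS; rewrite -wl.
  apply/eqP; apply: (minwin_splits_one_type WS iS jS wij lS l'S).
  by rewrite wl.
Qed.

End HomogeneousGame.

(** * Enumeration of the type weights *)

Section TypeWeights.

Variables (n : nat) (w : 'I_n -> nat).

Lemma mem_type_weights j : w j \in type_weights w.
Proof. by rewrite mem_sort mem_undup codom_f. Qed.

Lemma type_weightP t : 1 <= t <= num_types w -> exists j, w j = type_weight w t.
Proof.
case: t => // t ltt; have := mem_nth 0 (ltt : t < size (type_weights w)).
by rewrite mem_sort mem_undup => /codomP[j wj]; exists j.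
Qed.

Lemma type_weight_ltn s t : 1 <= s -> t <= num_types w -> s < t ->
  type_weight w s < type_weight w t.
Proof.
case: s t => // s [|t] // _ ltt lts.
have sorted_w : sorted ltn (type_weights w).
  by rewrite ltn_sorted_uniq_leq sort_uniq undup_uniq sort_sorted //; apply: leq_total.
by exact: (sorted_ltn_nth ltn_trans 0 sorted_w _ _ (ltn_trans (lts : s < t) ltt) ltt lts).
Qed.

Lemma type_weight_next t j : 1 <= t < num_types w ->
  type_weight w t < w j -> type_weight w t.+1 <= w j.
Proof.
move=> /andP[t0 ltt] ltj.
have ltm : index (w j) (type_weights w) < num_types w.
  by rewrite index_mem mem_type_weights.
have wj : w j = type_weight w (index (w j) (type_weights w)).+1.
  by rewrite /type_weight /= nth_index ?mem_type_weights.
move: ltm wj; move: (index _ _) => m ltm wj.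
have [ltm_|ltmt|tm] := ltngtP t m; last 2 first.
- suff : w j <= type_weight w t by rewrite leqNgt ltj.
  rewrite wj; move: ltmt; rewrite leq_eqVlt => /predU1P[->//|?].
  by apply/ltnW/type_weight_ltn => //; apply: ltnW.
- by rewrite wj tm.
by rewrite wj; apply/ltnW/type_weight_ltn.
Qed.

Lemma type_weight1 : (forall j, 0 < w j) -> (exists j, w j = 1) ->
  type_weight w 1 = 1.
Proof.
move=> w_gt0 [j wj].
have h_gt0 : 0 < num_types w.
  by have := mem_type_weights j; rewrite /num_types; case: (type_weights w).
have [i wi] := type_weightP (t := 1) h_gt0.
apply/eqP; rewrite eqn_leq -{2}wi w_gt0 andbT leqNgt; apply/negP => lt1.
have ltm : index (w j) (type_weights w) < num_types w.
  by rewrite index_mem mem_type_weights.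
have := nth_index 0 (mem_type_weights j); rewrite wj in ltm *.
move: ltm; case: (index _ _) => [|m] ltm e; first by move: lt1; rewrite /type_weight /= e.
have := @type_weight_ltn 1 m.+2 isT ltm isT.
by rewrite [type_weight w m.+2]e ltnNge ltnW.
Qed.

End TypeWeights.

(** * From the game to its weights *)

Section Representation.

Variables (n : nat) (v : {set 'I_n} -> bool) (q : nat) (w : 'I_n -> nat).
Hypotheses (pars : parsimonious v) (rep : min_homogeneous_rep v q w).
Local Notation W := (coalition_weight w).

Lemma minwin_cover j : exists2 S, min_winning v S & j \in S.
Proof.
have [/exists_inP[S mS jS]|] := boolP [exists (S | min_winning v S), j \in S].
  by exists S.
rewrite negb_exists_in => /forall_inP noS.
by case: (pars_nodummy pars (j := j)).
Qed.

Lemma rep_weight_gt0 j : 0 < w j.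
Proof.
have [S /andP[vS /forallP minS] jS] := minwin_cover j.
rewrite lt0n; apply/eqP => wj0.
have := minS (S :\ j); rewrite properD1 //= (minrep_winning rep).
by move: vS; rewrite (minrep_winning rep) (weightD1 w jS) wj0 add0n => ->.
Qed.

Lemma min_winningP S :
  reflect (q <= W S /\ {in S, forall j, W S < q + w j}) (min_winning v S).
Proof.
apply: (iffP andP) => -[vS minS]; split; rewrite ?(minrep_winning rep) // in vS *.
- move=> j jS; move/forallP/(_ (S :\ j)): minS; rewrite properD1 //=.
  by rewrite (minrep_winning rep) (weightD1 w jS) -ltnNge addnC ltn_add2r.
apply/forallP => T; apply/implyP => /properP[sTS [j jS jT]].
have := minS j jS; rewrite (minrep_winning rep) (weightD1 w jS) -ltnNge addnC ltn_add2r.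
by apply/leq_ltn_trans/weight_mono; rewrite subsetD1 sTS.
Qed.

(** Weights are positive, so dropping any player from weight exactly [q] loses; the converse is
    homogeneity. *)
Lemma min_winningE S : min_winning v S = (W S == q).
Proof.
apply/idP/eqP => [/(minrep_homogeneous rep)//|WS].
apply/min_winningP; rewrite WS leqnn; split=> // j _.
by rewrite -addn1 leq_add2l rep_weight_gt0.
Qed.

End Representation.

(** * Induction on the types *)

Theorem theorem5p1 (n : nat) (v : {set 'I_n} -> bool) (q : nat)
    (w : 'I_n -> nat) (k : nat) :
  parsimonious v ->
  min_homogeneous_rep v q w ->
  uniform k w ->
  forall t : nat, 1 <= t <= (num_types w).-1 -> type_weight w t = kfib k t.
Proof.
move=> pars rep [count _].
have w_gt0 := rep_weight_gt0 pars rep.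
have n_gt1 : 1 < n by apply: ltn_trans (pars_players pars).
have quotaE := minrep_quota rep.
have hom S : q <= coalition_weight w S ->
    {in S, forall j, coalition_weight w S < q + w j} -> coalition_weight w S = q.
  move=> qS minS; apply: (minrep_homogeneous rep).
  exact/(min_winningP rep).
have cover j : exists2 S, coalition_weight w S = q & j \in S.
  have [S mS jS] := minwin_cover pars j; exists S => //.
  exact: (minrep_homogeneous rep).
have unit := minrep_weight1 rep.
have card : #|[set S | coalition_weight w S == q]| = n.
  rewrite -[RHS](pars_minwin pars); apply: eq_card => S.
  by rewrite !inE (min_winningE pars rep).
(* The tower at type [t] is carried along, as it determines the next weight. *)
suff H t : 1 <= t <= (num_types w).-1 ->
    type_weight w t = kfib k t /\ tower w q k (kfib k t.-1) (kfib k t).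
  by move=> t /H[].
have base : 1 < num_types w -> 1 < k /\ tower w q k 0 1.
  move=> h_gt1; have w1 := type_weight1 w_gt0 unit.
  (* A player of the second type serves as the non-unit. *)
  have [h wh] := @type_weightP _ w 2 h_gt1.
  apply: (tower_base n_gt1 w_gt0 quotaE hom cover unit card (h := h)).
    by rewrite wh gtn_eqF // -[X in X < _]w1 type_weight_ltn.
  by rewrite -[RHS](count 1); [rewrite /type_count w1 | lia].
elim: t => // -[|t] IHt le_t.
  by rewrite type_weight1 //; split=> //=; apply: (base _).2; lia.
have [|wt tow] := IHt; first by lia.
have [|k_gt1 _] := base; first by lia.
have lt_t : type_weight w t.+1 < type_weight w t.+2 by apply: type_weight_ltn; lia.
have a_gt0 : 0 < kfib k t.+1.
  by rewrite -wt; have [|j <-] := @type_weightP _ w t.+1; first lia.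
have [|j||-> tow'] := tower_next n_gt1 w_gt0 quotaE hom cover unit card k_gt1 a_gt0 tow
  (c := type_weight w t.+2).
- by rewrite -wt.
- by rewrite -wt; apply: type_weight_next; lia.
- exact: count.
by [].
Qed.
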